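(* For all $k,s\in\mathbb{N}$, $$M_{s+1}^k-M_s^k=M_{sk+k}^{(k)}-M_{sk}^{(k)},$$ where $M_s^k$ denotes the $k$-th power of $M_s$.
   Context: The Mersenne numbers $(M_n)_{n\ge 0}$ are defined by $M_0=0$, $M_1=1$, $M_{n+2}=3M_{n+1}-2M_n$ for $n\ge 0$. Let $\lambda_1=2$ and $\lambda_2=1$ be the roots of $\lambda^2-3\lambda+2=0$. For integers $n\ge 0$, $k\ge 1$, write uniquely $n=sk+r$ with integers $s\ge 0$ and $0\le r<k$; the generalized $k$-Mersenne number is $M_n^{(k)}=(\lambda_1^{s}-\lambda_2^{s})^{k-r}(\lambda_1^{s+1}-\lambda_2^{s+1})^{r}$. $\mathbb{N}$ denotes the positive integers. *)

(* Defs.v *)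
From mathcomp Require Import all_boot all_order all_algebra.

Set Implicit Arguments.
Unset Strict Implicit.
Unset Printing Implicit Defensive.

Import GRing.Theory.
Local Open Scope ring_scope.

Fixpoint mersenne (n : nat) : int :=
  match n with
  | 0 => 0
  | n'.+1 => match n' with
             | 0 => 1
             | m.+1 => 3 * mersenne n' - 2 * mersenne m
             end
  end.

(* The roots of x ^ 2 - 3 x + 2. *)
Definition lambda1 : int := 2.
Definition lambda2 : int := 1.

(* For 0 < k, the unique decomposition n = s * k + r with r < k is given by
   Euclidean division: s = n %/ k and r = n %% k. *)
Definition gen_mersenne (k n : nat) : int :=
  let s := (n %/ k)%N in
  let r := (n %% k)%N in
  (lambda1 ^+ s - lambda2 ^+ s) ^+ (k - r)
  * (lambda1 ^+ s.+1 - lambda2 ^+ s.+1) ^+ r.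

(* Main.v *)
Require Import Defs.
From mathcomp Require Import all_boot all_order all_algebra.
From mathcomp Require Import ring.

Set Implicit Arguments.
Unset Strict Implicit.
Unset Printing Implicit Defensive.

Import GRing.Theory.
Local Open Scope ring_scope.

(** Since [lambda1 - lambda2 = 1], Binet's formula for the Mersenne numbers has
    no denominator: [mersenne s = lambda1 ^+ s - lambda2 ^+ s].  At a multiple
    [s * k] of [k] the remainder is zero, so the second factor of the
    generalized number disappears and what is left is the [k]-th power of that
    Binet expression ([gen_mersenne_mul]).  The two indices in the theorem are
    the consecutive multiples [s.+1 * k] and [s * k], and the identity holds
    term by term. *)

(** The recurrence has order two, so the induction carries the formula at two
    consecutive indices. *)
Lemma mersenne_Binet n : mersenne n = lambda1 ^+ n - lambda2 ^+ n.
Proof.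
suff [] : mersenne n = lambda1 ^+ n - lambda2 ^+ n /\
          mersenne n.+1 = lambda1 ^+ n.+1 - lambda2 ^+ n.+1 by [].
elim: n => [|n [IHn IHn1]]; first by [].
split=> //.
have -> : mersenne n.+2 = 3 * mersenne n.+1 - 2 * mersenne n by [].
by rewrite IHn1 IHn /lambda1 /lambda2 !expr1n !exprS; ring.
Qed.

Lemma gen_mersenne_mul k s : (0 < k)%N ->
  gen_mersenne k (s * k) = mersenne s ^+ k.
Proof.
move=> k_gt0.
by rewrite /gen_mersenne mulnK // modnMl subn0 expr0 mulr1 mersenne_Binet.
Qed.

Theorem theorem2p2 (k s : nat) (hk : (0 < k)%N) (hs : (0 < s)%N) :
  mersenne s.+1 ^+ k - mersenne s ^+ k
  = gen_mersenne k (s * k + k)%N - gen_mersenne k (s * k)%N.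
Proof. by rewrite -mulSnr !gen_mersenne_mul. Qed.
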